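(* Let $k$ be a field. For an integer $n\ge 1$, let $P_n=\{0,1,\ldots,n\}^2$ be the $(n+1)\times(n+1)$ grid poset with the product order, and let $A_n=kP_n$ be its incidence algebra. Let $M_n=\bigoplus_{j=0}^{n}S_{(j,j)}$ be the direct sum of the simple $P_n$-persistence modules at the diagonal vertices. Then $\mathrm{Ext}^2_{A_n}(M_n,M_n)\cong k^n$ for every $n\ge 1$. In particular, the dimension of $\mathrm{Ext}^2_{A_n}(M_n,M_n)$ grows linearly with $n$.
   Context: For a poset $P$, viewed as a small category with a unique morphism $p\to q$ whenever $p\le q$, a $P$-persistence module is a (covariant) functor $M:P\to\mathbf{Vec}_k$ to the category of $k$-vector spaces. For finite $P$, finite-dimensional $P$-persistence modules are identified with finite-dimensional modules over the incidence algebra $A=kP$, and $\mathrm{Ext}^i_A$ is computed in this abelian category (equivalently, in the functor category). The simple module $S_v$ at $v\in P$ takes the value $k$ at $v$ and $0$ at every other vertex. *)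

(* Defs.v *)
From HB Require Import structures.
From mathcomp Require Import all_boot all_order all_algebra.

Set Implicit Arguments.
Unset Strict Implicit.
Unset Printing Implicit Defensive.

Import Order.TTheory GRing.Theory.
Import VectorInternalTheory.
Local Open Scope ring_scope.

Section DependentProduct.
Variables (k : fieldType) (I : finType) (T : I -> vectType k).
Local Notation prodT := {dffun forall i : I, T i}.
Implicit Types f g : prodT.

Definition dprod_zero : prodT := [ffun i => 0 : T i].
Definition dprod_opp f : prodT := [ffun i => - f i : T i].
Definition dprod_add f g : prodT := [ffun i => f i + g i : T i].
Definition dprod_scale (a : k) f : prodT := [ffun i => a *: f i : T i].

Fact dprod_addA : associative dprod_add.
Proof. by move=> f g h; apply/ffunP=> i; rewrite !ffunE addrA. Qed.
Fact dprod_addC : commutative dprod_add.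
Proof. by move=> f g; apply/ffunP=> i; rewrite !ffunE addrC. Qed.
Fact dprod_add0 : left_id dprod_zero dprod_add.
Proof. by move=> f; apply/ffunP=> i; rewrite !ffunE add0r. Qed.
Fact dprod_addN : left_inverse dprod_zero dprod_opp dprod_add.
Proof. by move=> f; apply/ffunP=> i; rewrite !ffunE addNr. Qed.

HB.instance Definition _ := GRing.isZmodule.Build prodT
  dprod_addA dprod_addC dprod_add0 dprod_addN.

Fact dprod_scaleA a b f : dprod_scale a (dprod_scale b f) = dprod_scale (a * b) f.
Proof. by apply/ffunP=> i; rewrite !ffunE scalerA. Qed.
Fact dprod_scale1 : left_id 1 dprod_scale.
Proof. by move=> f; apply/ffunP=> i; rewrite !ffunE scale1r. Qed.
Fact dprod_scaleDr : right_distributive dprod_scale +%R.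
Proof. by move=> a f g; apply/ffunP=> i; rewrite !ffunE scalerDr. Qed.
Fact dprod_scaleDl f : {morph dprod_scale^~ f : a b / a + b}.
Proof. by move=> a b; apply/ffunP=> i; rewrite !ffunE scalerDl. Qed.

HB.instance Definition _ := GRing.Zmodule_isLmodule.Build k prodT
  dprod_scaleA dprod_scale1 dprod_scaleDr dprod_scaleDl.

Fact dprod_vect_iso :
  Vector.axiom (\sum_(j < #|I|) dim (T (enum_val j))) prodT.
Proof.
exists (fun f : prodT => \mxrow_j v2r (f (enum_val j))).
  move=> a f g; apply/mxrowP=> j.
  have lin (A B : 'rV[k]_(\sum_(j < #|I|) dim (T (enum_val j)))) :
    submxrow (a *: A + B) j = a *: submxrow A j + submxrow B j.
    by apply/rowP=> l; rewrite !mxE.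
  by rewrite lin !mxrowK !ffunE linearP.
pose h (w : 'rV[k]_(\sum_(j < #|I|) dim (T (enum_val j)))) : prodT :=
  [ffun i => ecast i (T i) (enum_rankK i) (r2v (submxrow w (enum_rank i)))].
have hE w j : h w (enum_val j) = r2v (submxrow w j).
  rewrite ffunE; move: (enum_rankK _) => e.
  have ej : enum_rank (enum_val j) = j by exact: enum_valK.
  by case: _ / (esym ej) e => e; rewrite eq_axiomK.
exists h => [f|w].
  apply/ffunP=> i; rewrite -(enum_rankK i) hE mxrowK v2rK //.
by apply/mxrowP=> j; rewrite mxrowK hE r2vK.
Qed.

HB.instance Definition _ := Lmodule_hasFinDim.Build k prodT dprod_vect_iso.

End DependentProduct.

Section QuotientSpace.
Variables (k : fieldType) (V : vectType k) (W : {vspace V}).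

Definition quotv : Type := Quotient.quot (pred_of_vspace W).
HB.instance Definition _ := GRing.Zmodule.on quotv.

Definition qclass (v : V) : quotv := (\pi_(Quotient.quot (pred_of_vspace W)) v)%qT.
Definition qrepr (q : quotv) : V := repr (q : Quotient.quot (pred_of_vspace W)).

Lemma qreprK : cancel qrepr qclass.
Proof. by move=> q; apply: reprK. Qed.

Lemma qclass_eq u v : (qclass u == qclass v) = (u - v \in W).
Proof. by rewrite Quotient.idealrBE. Qed.

Lemma qclassD u v : qclass (u + v) = qclass u + qclass v.
Proof. exact: Quotient.pi_add. Qed.

Definition quotv_scale (a : k) (q : quotv) : quotv := qclass (a *: qrepr q).

Lemma qclass_scale a v : quotv_scale a (qclass v) = qclass (a *: v).
Proof.
by apply/eqP; rewrite qclass_eq -scalerBr memvZ // -qclass_eq qreprK.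
Qed.

Fact quotv_scaleA a b q :
  quotv_scale a (quotv_scale b q) = quotv_scale (a * b) q.
Proof. by rewrite -(qreprK q) !qclass_scale scalerA. Qed.
Fact quotv_scale1 : left_id 1 quotv_scale.
Proof. by move=> q; rewrite -(qreprK q) qclass_scale scale1r. Qed.
Fact quotv_scaleDr : right_distributive quotv_scale +%R.
Proof.
move=> a p q; rewrite -(qreprK p) -(qreprK q).
by rewrite -qclassD !qclass_scale scalerDr qclassD.
Qed.
Fact quotv_scaleDl q : {morph quotv_scale^~ q : a b / a + b}.
Proof.
by move=> a b; rewrite -(qreprK q) !qclass_scale scalerDl qclassD.
Qed.

HB.instance Definition _ := GRing.Zmodule_isLmodule.Build k quotv
  quotv_scaleA quotv_scale1 quotv_scaleDr quotv_scaleDl.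

Fact qclass_is_linear : linear qclass.
Proof. by move=> a u v; rewrite qclassD -qclass_scale. Qed.
HB.instance Definition _ := GRing.isLinear.Build k V quotv _ qclass
  qclass_is_linear.

Fact quotv_vect_iso : Vector.axiom (dim (subvs_of (W^C)%VS)) quotv.
Proof.
pose pr v : subvs_of (W^C)%VS := vsproj _ (daddv_pi (W^C) W v).
have capW : (W^C :&: W = 0)%VS by rewrite capvC capv_compl.
have prE v : v - vsval (pr v) \in W.
  rewrite /pr vsprojK ?memv_pi //.
  have /(daddv_pi_add capW) e : v \in (W^C + W)%VS by rewrite addvC addv_complf memvf.
  by rewrite -{1}e addrC addKr memv_pi.
have pr0 v : v \in W -> pr v = 0.
  move=> Wv; apply/val_inj/eqP; rewrite -memv0 -capW memv_cap subvsP /=.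
  by have := memvB Wv (prE v); rewrite opprB addrC subrK.
have prL : linear pr by move=> a u v; rewrite /pr !linearP.
pose prl : {linear _ -> _} := HB.pack pr (GRing.isLinear.Build _ _ _ _ pr prL).
have pr_eq u v : u - v \in W -> pr u = pr v.
  by move/pr0 => /(congr1 (+%R^~ (pr v))); rewrite add0r => <-; rewrite -[pr]/(prl : _ -> _) linearB subrK.
exists (fun q => v2r (pr (qrepr q))).
  move=> a p q; rewrite -linearP -prL; congr v2r; apply: pr_eq.
  rewrite -qclass_eq qreprK; apply/eqP.
  by rewrite qclass_is_linear !qreprK.
exists (fun r => qclass (vsval (r2v r : subvs_of (W^C)%VS))) => [q|r].
  rewrite v2rK -[RHS]qreprK; apply/eqP.
  by rewrite qclass_eq -opprB memvN prE.
rewrite -[RHS]r2vK; congr v2r; set w := r2v r.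
transitivity (pr (vsval w)); first by apply: pr_eq; rewrite -qclass_eq qreprK.
apply/val_inj; rewrite /pr /= vsprojK ?memv_pi // daddv_pi_id //; exact: subvsP.
Qed.

HB.instance Definition _ := Lmodule_hasFinDim.Build k quotv quotv_vect_iso.

End QuotientSpace.

Section PersistenceModules.
Variables (disp : Order.disp_t) (P : finPOrderType disp) (k : fieldType).

(* Functors from P to finite-dimensional k-vector spaces. The proof argument of
   [pmap] is irrelevant: it inhabits an equality of booleans. *)
Record pmod := PMod {
  pobj :> P -> vectType k;
  pmap : forall p q : P, (p <= q)%O -> 'Hom(pobj p, pobj q);
  pmap_id : forall p (pp : (p <= p)%O), pmap pp = \1%VF;
  pmap_comp : forall p q r (pq : (p <= q)%O) (qr : (q <= r)%O) (pr : (p <= r)%O),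
    pmap pr = (pmap qr \o pmap pq)%VF
}.

Arguments pobj : simpl never.

Section Hom.
Variables M N : pmod.

Local Notation family := {dffun forall p : P, 'Hom(M p, N p)}.
Local Notation arrow := {pq : P * P | (pq.1 <= pq.2)%O}.

Definition nat_defect (e : arrow) (f : family) :
    'Hom(M (sval e).1, N (sval e).2) :=
  ((pmap N (svalP e) \o f (sval e).1) - (f (sval e).2 \o pmap M (svalP e)))%VF.

Fact nat_defect_is_linear e : linear (nat_defect e).
Proof.
move=> a f g; rewrite /nat_defect !ffunE.
by rewrite !comp_lfunDr !comp_lfunDl -!comp_lfunZr -!comp_lfunZl
  scalerBr opprD addrACA.
Qed.
HB.instance Definition _ e := GRing.isLinear.Build k _ _ _ (nat_defect e)
  (nat_defect_is_linear e).

Definition nat_trans : {vspace family} :=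
  (\bigcap_(e : arrow) lker (linfun (nat_defect e)))%VS.

Lemma nat_transP (f : family) :
  reflect (forall p q (pq : (p <= q)%O),
             (pmap N pq \o f p = f q \o pmap M pq)%VF)
          (f \in nat_trans).
Proof.
rewrite memvE; apply: (iffP subv_bigcapP) => [H p q pq|H e _].
  have := H (exist _ (p, q) pq) isT.
  rewrite -memvE memv_ker lfunE /= /nat_defect subr_eq0 => /eqP /=.
  by rewrite (bool_irrelevance (svalP (exist _ (p, q) pq)) pq).
by rewrite -memvE memv_ker lfunE /= /nat_defect H subrr.
Qed.

(* A vectType, as the subspace [nat_trans] of the families of linear maps. *)
Definition hom := subvs_of nat_trans.
HB.instance Definition _ := Vector.on hom.

Definition homc (f : hom) (p : P) : 'Hom(M p, N p) := vsval f p.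

Lemma homP (f g : hom) : (forall p, homc f p = homc g p) -> f = g.
Proof. by move=> e; apply/val_inj/ffunP. Qed.

Lemma hom_nat (f : hom) p q (pq : (p <= q)%O) :
  (pmap N pq \o homc f p = homc f q \o pmap M pq)%VF.
Proof. exact: nat_transP (subvsP f) _ _ _. Qed.

Lemma hom_natE (f : hom) p q (pq : (p <= q)%O) x :
  pmap N pq (homc f p x) = homc f q (pmap M pq x).
Proof. by rewrite -!comp_lfunE hom_nat. Qed.

Fact mkhom_subproof (F : forall p, 'Hom(M p, N p)) :
  (forall p q (pq : (p <= q)%O), (pmap N pq \o F p = F q \o pmap M pq)%VF) ->
  ([ffun p => F p] : family) \in nat_trans.
Proof. by move=> nF; apply/nat_transP => p q pq; rewrite !ffunE. Qed.

Definition mkhom F nF : hom := Subvs (@mkhom_subproof F nF).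

Lemma mkhomE F nF p : homc (@mkhom F nF) p = F p.
Proof. by rewrite /homc /= ffunE. Qed.

End Hom.

Fact homcomp_subproof (L M N : pmod) (g : hom M N) (f : hom L M) p q
    (pq : (p <= q)%O) :
  (pmap N pq \o (homc g p \o homc f p) = (homc g q \o homc f q) \o pmap L pq)%VF.
Proof. by rewrite comp_lfunA hom_nat -comp_lfunA hom_nat comp_lfunA. Qed.

Definition homcomp L M N (g : hom M N) (f : hom L M) : hom L N :=
  mkhom (homcomp_subproof g f).

(* Epimorphisms of functors to vector spaces are the pointwise surjections. *)
Definition epi M N (g : hom M N) := forall p, limg (homc g p) = fullv.

Definition projective (Q : pmod) :=
  forall (M N : pmod) (g : hom M N) (h : hom Q N), epi g ->
  exists h' : hom Q M, homcomp g h' = h.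

Record proj_resolution (M : pmod) := ProjResolution {
  res_obj : nat -> pmod;
  res_d : forall i, hom (res_obj i.+1) (res_obj i);
  res_aug : hom (res_obj 0) M;
  res_proj : forall i, projective (res_obj i);
  res_aug_epi : epi res_aug;
  res_exact0 : forall p, limg (homc (res_d 0) p) = lker (homc res_aug p);
  res_exactS : forall i p,
    limg (homc (res_d i.+1) p) = lker (homc (res_d i) p)
}.

Section HomComplex.
Variables (M : pmod) (R : proj_resolution M) (N : pmod).

Definition precomp L L' (f : hom L L') (g : hom L' N) : hom L N := homcomp g f.

Fact precomp_is_linear L L' (f : hom L L') : linear (precomp f).
Proof.
move=> a g h; apply: homP => p; rewrite /precomp mkhomE.
rewrite /homc linearP /= !ffunE -/(homc f p).
by rewrite comp_lfunDl comp_lfunZl.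
Qed.
HB.instance Definition _ L L' (f : hom L L') :=
  GRing.isLinear.Build k _ _ _ (precomp f) (precomp_is_linear f).

Definition codiff i : 'Hom(hom (res_obj R i) N, hom (res_obj R i.+1) N) :=
  linfun (precomp (res_d R i)).

Definition cocycles i := lker (codiff i).

Definition coboundaries i : {vspace hom (res_obj R i) N} :=
  match i with 0 => 0%VS | j.+1 => limg (codiff j) end.

(* H^i of 0 -> Hom(R_0, N) -> Hom(R_1, N) -> ..., the coboundaries being viewed
   inside the space of cocycles. *)
Definition cohomology i : vectType k :=
  quotv (linfun (vsval : subvs_of (cocycles i) -> _) @^-1: coboundaries i)%VS.

End HomComplex.

Section Simple.
Variable v : P.

(* k^1 at v and k^0 elsewhere: the boolean p == v is coerced to nat. *)
Definition simple_obj (p : P) : vectType k := 'rV[k]_(p == v).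

(* The only non-empty matrix const_mx 1 below is the identity of k^1. *)
Definition simple_map p q (_ : (p <= q)%O) : 'Hom(simple_obj p, simple_obj q) :=
  linfun (mulmxr (const_mx 1 : 'M[k]_(p == v, q == v))).

Fact simple_id p (pp : (p <= p)%O) : simple_map pp = \1%VF.
Proof.
apply/lfunP=> x; rewrite !lfunE /=; rewrite -[RHS]mulmx1; congr mulmx.
by apply/matrixP => i j; rewrite !mxE; case: (p == v) i j => [] [[|//] ?] [[|//] ?].
Qed.

Fact simple_comp p q r (pq : (p <= q)%O) (qr : (q <= r)%O) (pr : (p <= r)%O) :
  simple_map pr = (simple_map qr \o simple_map pq)%VF.
Proof.
apply/lfunP=> x; rewrite !lfunE /= !lfunE /= -mulmxA; congr mulmx.
apply/matrixP => i j; rewrite !mxE.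
have pv : p == v by move: (i); case: eqP => // _ [].
have rv : r == v by move: (j); case: eqP => // _ [].
have qv : q == v by move: qr pq; rewrite (eqP rv) (eqP pv) eq_le => -> ->.
by rewrite qv big_ord1 !mxE mulr1.
Qed.

Definition simple_mod := PMod simple_id simple_comp.
End Simple.

Section DirectSum.
Variables (I : finType) (F : I -> pmod).

Definition dsum_obj p : vectType k := {dffun forall i : I, F i p}.

Definition dsum_fun p q (pq : (p <= q)%O) (f : dsum_obj p) : dsum_obj q :=
  [ffun i => pmap (F i) pq (f i)].

Fact dsum_fun_is_linear p q (pq : (p <= q)%O) : linear (dsum_fun pq).
Proof. by move=> a f g; apply/ffunP=> i; rewrite !ffunE linearP. Qed.
HB.instance Definition _ p q (pq : (p <= q)%O) :=
  GRing.isLinear.Build k _ _ _ (dsum_fun pq) (dsum_fun_is_linear pq).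

Definition dsum_map p q (pq : (p <= q)%O) : 'Hom(dsum_obj p, dsum_obj q) :=
  linfun (dsum_fun pq).

Fact dsum_id p (pp : (p <= p)%O) : dsum_map pp = \1%VF.
Proof.
by apply/lfunP=> f; rewrite !lfunE /=; apply/ffunP=> i; rewrite ffunE pmap_id lfunE.
Qed.

Fact dsum_comp p q r (pq : (p <= q)%O) (qr : (q <= r)%O) (pr : (p <= r)%O) :
  dsum_map pr = (dsum_map qr \o dsum_map pq)%VF.
Proof.
apply/lfunP=> f; rewrite !lfunE /= !lfunE /=; apply/ffunP=> i.
by rewrite !ffunE (pmap_comp _ pq qr) lfunE.
Qed.

Definition dsum := PMod dsum_id dsum_comp.
End DirectSum.

(* The module generated freely by the vector space V placed at v: it is V at
   every p >= v, with identity transition maps, and 0 elsewhere. *)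
Section Free.
Variables (v : P) (V : vectType k).

Definition free_obj (p : P) : vectType k := {ffun 'I_(v <= p)%O -> V}.

Definition free_fun p q (_ : (p <= q)%O) (f : free_obj p) : free_obj q :=
  [ffun _ => \sum_i f i].

Fact free_fun_is_linear p q (pq : (p <= q)%O) : linear (free_fun pq).
Proof.
move=> a f g; apply/ffunP=> i; rewrite !ffunE scaler_sumr -big_split.
by apply: eq_bigr => j _; rewrite !ffunE.
Qed.
HB.instance Definition _ p q (pq : (p <= q)%O) :=
  GRing.isLinear.Build k _ _ _ (free_fun pq) (free_fun_is_linear pq).

Definition free_map p q (pq : (p <= q)%O) : 'Hom(free_obj p, free_obj q) :=
  linfun (free_fun pq).

Lemma le_of_ord p (i : 'I_(v <= p)%O) : (v <= p)%O.
Proof. by case: (v <= p)%O i => // -[]. Qed.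

Lemma sum_bool (U : nmodType) (b : bool) (i : 'I_b) (G : 'I_b -> U) : \sum_j G j = G i.
Proof.
case: b i G => [i G|[] //]; rewrite big_ord1; congr G.
by apply/val_inj; case: i => [[]].
Qed.

Fact free_id p (pp : (p <= p)%O) : free_map pp = \1%VF.
Proof.
by apply/lfunP=> f; rewrite !lfunE /=; apply/ffunP=> i; rewrite ffunE (sum_bool i).
Qed.

Fact free_comp p q r (pq : (p <= q)%O) (qr : (q <= r)%O) (pr : (p <= r)%O) :
  free_map pr = (free_map qr \o free_map pq)%VF.
Proof.
apply/lfunP=> f; rewrite !lfunE /= !lfunE /=; apply/ffunP=> i; rewrite !ffunE.
have [vp|vp] := orP (orbN (v <= p)%O).
  have j : 'I_(v <= q)%O by rewrite (le_trans vp pq); exact: ord0.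
  by rewrite (sum_bool j) ffunE.
rewrite big1 ?big1 // => [j _|j _]; last by case/negP: vp; apply: le_of_ord j.
by rewrite ffunE big1 // => l _; case/negP: vp; apply: le_of_ord l.
Qed.

Definition free_mod := PMod free_id free_comp.

Section FreeHom.
Variables (N : pmod) (x : 'Hom(V, N v)).

Definition free_hom_fun p (f : free_mod p) : N p :=
  \sum_(i < (v <= p)%O) pmap N (le_of_ord i) (x (f i)).

Fact free_hom_fun_is_linear p : linear (@free_hom_fun p).
Proof.
move=> a f g; rewrite /free_hom_fun scaler_sumr -big_split.
by apply: eq_bigr => i _; rewrite !ffunE !linearP.
Qed.
HB.instance Definition _ p := GRing.isLinear.Build k _ _ _ (@free_hom_fun p)
  (@free_hom_fun_is_linear p).

Fact free_hom_subproof p q (pq : (p <= q)%O) :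
  (pmap N pq \o linfun (@free_hom_fun p) =
   linfun (@free_hom_fun q) \o pmap free_mod pq)%VF.
Proof.
apply/lfunP=> f; rewrite !comp_lfunE !(lfunE (@free_hom_fun _)) /= !lfunE /=.
rewrite /free_hom_fun linear_sum.
have [vp|vp] := orP (orbN (v <= p)%O); last first.
  rewrite big1 => [|j _]; last by case/negP: vp; apply: le_of_ord j.
  rewrite big1 // => j _; rewrite ffunE big1 ?linear0 // => l _.
  by case/negP: vp; apply: le_of_ord l.
have i : 'I_(v <= p)%O by rewrite vp; exact: ord0.
have j : 'I_(v <= q)%O by rewrite (le_trans vp pq); exact: ord0.
rewrite (sum_bool i) (sum_bool j) ffunE (sum_bool i).
by rewrite (pmap_comp N (le_of_ord i) pq) comp_lfunE.
Qed.

Definition free_hom : hom free_mod N := mkhom free_hom_subproof.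

Lemma free_homE p f : homc free_hom p f = free_hom_fun f.
Proof. by rewrite mkhomE lfunE. Qed.
End FreeHom.

End Free.

Lemma comp_mkhom (L M N : pmod) (g : hom M N) (f : hom L M) p x :
  homc (homcomp g f) p x = homc g p (homc f p x).
Proof. by rewrite mkhomE comp_lfunE. Qed.

Lemma epi_sect M N (g : hom M N) p y :
  epi g -> homc g p ((homc g p)^-1%VF y) = y.
Proof. by move=> /(_ p) eg; apply: limg_lfunVK; rewrite eg memvf. Qed.

Lemma free_projective v V : projective (free_mod v V).
Proof.
move=> M N g h epi_g.
pose u (y : V) : free_mod v V v := [ffun _ => y].
have uL : linear u by move=> a y z; apply/ffunP=> i; rewrite !ffunE.
pose ul : {linear _ -> _} := HB.pack u (GRing.isLinear.Build _ _ _ _ u uL).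
pose U : 'Hom(V, free_mod v V v) := linfun u.
have UE y : U y = u y := lfunE ul y.
pose x := ((homc g v)^-1 \o homc h v \o U)%VF.
exists (free_hom x); apply: homP => p; apply/lfunP=> f.
rewrite comp_mkhom free_homE linear_sum /=.
have [vp|vp] := orP (orbN (v <= p)%O); last first.
  have -> : f = 0.
    by apply/ffunP=> i; case/negP: vp; apply: le_of_ord i.
  by rewrite linear0 big1 // => i _; rewrite ffunE !linear0.
have i : 'I_(v <= p)%O by rewrite vp; exact: ord0.
have vp' := le_of_ord i.
rewrite (sum_bool i) -hom_natE !comp_lfunE epi_sect //.
rewrite hom_natE; congr (homc h p _).
rewrite UE [LHS]lfunE; apply/ffunP=> j; rewrite ffunE.
have i0 : 'I_(v <= v)%O by rewrite lexx; exact: ord0.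
rewrite (sum_bool i0) ffunE; congr (f _).
by apply/val_inj; move: (vp); case: (v <= p)%O i j => // -[[]//?] [[]].
Qed.

Section DirectSumHom.
Variables (I : finType) (F : I -> pmod) (N : pmod).

Definition dsum_incl_fun i p (x : F i p) : dsum F p :=
  [ffun j => dfwith (fun j => 0 : F j p) x j].

Fact dsum_incl_fun_is_linear i p : linear (@dsum_incl_fun i p).
Proof.
move=> a x y; apply/ffunP=> j; rewrite !ffunE.
have [<-|ne] := eqVneq i j; first by rewrite !dfwith_in.
by rewrite !dfwith_out // scaler0 addr0.
Qed.
HB.instance Definition _ i p := GRing.isLinear.Build k _ _ _
  (@dsum_incl_fun i p) (@dsum_incl_fun_is_linear i p).

Fact dsum_incl_subproof i p q (pq : (p <= q)%O) :
  (pmap (dsum F) pq \o linfun (@dsum_incl_fun i p) =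
   linfun (@dsum_incl_fun i q) \o pmap (F i) pq)%VF.
Proof.
apply/lfunP=> x; rewrite !comp_lfunE !lfunE /=; apply/ffunP=> j; rewrite !ffunE.
have [<-|ne] := eqVneq i j; first by rewrite !dfwith_in.
by rewrite !dfwith_out // linear0.
Qed.
Definition dsum_incl i : hom (F i) (dsum F) := mkhom (@dsum_incl_subproof i).

Lemma dsum_inclE i p x j :
  homc (dsum_incl i) p x j = dfwith (fun j => 0 : F j p) x j.
Proof. by rewrite mkhomE lfunE /= ffunE. Qed.

Variable h : forall i, hom (F i) N.

Definition dsum_hom_fun p (f : dsum F p) : N p := \sum_i homc (h i) p (f i).

Fact dsum_hom_fun_is_linear p : linear (@dsum_hom_fun p).
Proof.
move=> a f g; rewrite /dsum_hom_fun scaler_sumr -big_split.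
by apply: eq_bigr => i _; rewrite !ffunE !linearP.
Qed.
HB.instance Definition _ p := GRing.isLinear.Build k _ _ _ (@dsum_hom_fun p)
  (@dsum_hom_fun_is_linear p).

Fact dsum_hom_subproof p q (pq : (p <= q)%O) :
  (pmap N pq \o linfun (@dsum_hom_fun p) =
   linfun (@dsum_hom_fun q) \o pmap (dsum F) pq)%VF.
Proof.
apply/lfunP=> f; rewrite !comp_lfunE !(lfunE (@dsum_hom_fun _)) /= lfunE /=.
rewrite /dsum_hom_fun linear_sum; apply: eq_bigr => i _.
by rewrite ffunE /= hom_natE.
Qed.
Definition dsum_hom : hom (dsum F) N := mkhom dsum_hom_subproof.

Lemma dsum_homE p f : homc dsum_hom p f = dsum_hom_fun f.
Proof. by rewrite mkhomE lfunE. Qed.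

End DirectSumHom.

Lemma dsum_decomp (I : finType) (F : I -> pmod) p (f : dsum F p) :
  f = \sum_i homc (dsum_incl F i) p (f i).
Proof.
pose ev j (g : dsum F p) : F j p := g j.
have evL j : linear (ev j) by move=> a g g'; rewrite /ev !ffunE.
pose evl j : {linear _ -> _} :=
  HB.pack (ev j) (GRing.isLinear.Build _ _ _ _ (ev j) (evL j)).
apply/ffunP=> j; rewrite -[RHS]/(evl j _) linear_sum (bigD1 j) //=.
rewrite big1 ?addr0 => [|i ne]; rewrite /ev mkhomE lfunE /= ffunE.
  by rewrite dfwith_in.
by rewrite dfwith_out.
Qed.

Lemma dsum_projective (I : finType) (F : I -> pmod) :
  (forall i, projective (F i)) -> projective (dsum F).
Proof.
move=> projF M N g h epi_g.
have /fin_all_exists[h' h'E] i := projF i M N g (homcomp h (dsum_incl F i)) epi_g.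
exists (dsum_hom h'); apply: homP => p; apply/lfunP=> f.
rewrite comp_mkhom dsum_homE linear_sum [in RHS](dsum_decomp f) linear_sum.
apply: eq_bigr => i _.
by rewrite /= -!comp_mkhom h'E.
Qed.

Section Kernel.
Variables (M N : pmod) (g : hom M N).

Definition ker_obj p : vectType k := subvs_of (lker (homc g p)).
Definition ker_map p q (pq : (p <= q)%O) : 'Hom(ker_obj p, ker_obj q) :=
  (linfun (vsproj (lker (homc g q))) \o pmap M pq \o linfun vsval)%VF.

Lemma ker_mapE p q (pq : (p <= q)%O) x :
  vsval (ker_map pq x) = pmap M pq (vsval x).
Proof.
rewrite !comp_lfunE /= !lfunE /= vsprojK //.
rewrite memv_ker -hom_natE.
by have := subvsP x; rewrite memv_ker => /eqP ->; rewrite linear0.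
Qed.

Fact ker_id p (pp : (p <= p)%O) : ker_map pp = \1%VF.
Proof.
by apply/lfunP=> x; apply/val_inj; rewrite /= ker_mapE pmap_id !lfunE.
Qed.
Fact ker_comp p q r (pq : (p <= q)%O) (qr : (q <= r)%O) (pr : (p <= r)%O) :
  ker_map pr = (ker_map qr \o ker_map pq)%VF.
Proof.
apply/lfunP=> x; apply/val_inj.
by rewrite comp_lfunE /= !ker_mapE (pmap_comp _ pq qr) comp_lfunE.
Qed.
Definition kermod := PMod ker_id ker_comp.

Fact ker_incl_subproof p q (pq : (p <= q)%O) :
  (pmap M pq \o linfun (vsval : kermod p -> M p) =
   linfun vsval \o pmap kermod pq)%VF.
Proof.
apply/lfunP=> x; rewrite comp_lfunE [RHS]comp_lfunE !(lfunE vsval).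
exact: esym (ker_mapE pq x).
Qed.
Definition ker_incl : hom kermod M := mkhom ker_incl_subproof.

Lemma ker_inclE p x : homc ker_incl p x = vsval x.
Proof. by rewrite mkhomE lfunE. Qed.

End Kernel.

Section StandardResolution.

(* Epimorphism onto M from the projective (+)_v k[v <= -] (x) M(v); iterating on kernels
   of the counits gives a projective resolution of M. *)
Definition cover (M : pmod) : pmod := dsum (fun v => free_mod v (M v)).

Definition counit (M : pmod) : hom (cover M) M :=
  dsum_hom (fun v => @free_hom v (M v) M \1%VF).

Lemma cover_projective M : projective (cover M).
Proof. by apply: dsum_projective => v; apply: free_projective. Qed.

Lemma counit_epi M : epi (counit M).
Proof.
move=> p; apply/eqP; rewrite eqEsubv subvf /=; apply/subvP=> y _.
pose x : free_mod p (M p) p := [ffun _ => y].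
pose f := homc (dsum_incl (fun v => free_mod v (M v)) p) p x.
apply/memv_imgP; exists f; first exact: memvf.
rewrite dsum_homE /dsum_hom_fun (bigD1 p) // big1 ?addr0; last first.
  by move=> v ne; rewrite /f dsum_inclE dfwith_out ?linear0 // eq_sym.
rewrite /f dsum_inclE dfwith_in free_homE /free_hom_fun.
have i : 'I_(p <= p)%O by rewrite lexx; exact: ord0.
by rewrite (sum_bool i) pmap_id !id_lfunE [RHS]addr0 ffunE.
Qed.

Variable M : pmod.

Definition syzygy i : pmod := iter i (fun L => kermod (counit L)) M.

Definition std_d i : hom (cover (syzygy i.+1)) (cover (syzygy i)) :=
  homcomp (ker_incl (counit (syzygy i))) (counit (syzygy i.+1)).

Lemma std_d_img i p : limg (homc (std_d i) p) = lker (homc (counit (syzygy i)) p).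
Proof.
rewrite mkhomE limg_comp (@counit_epi (syzygy i.+1) p).
apply/eqP; rewrite eqEsubv; apply/andP; split; apply/subvP=> y.
  by case/memv_imgP => x _ ->; rewrite ker_inclE; apply: subvsP.
move=> Ky; apply/memv_imgP; exists (Subvs Ky); first exact: memvf.
by rewrite ker_inclE.
Qed.

Lemma std_exact i p : limg (homc (std_d i.+1) p) = lker (homc (std_d i) p).
Proof.
rewrite std_d_img; apply/vspaceP=> x; rewrite !memv_ker comp_mkhom ker_inclE.
by rewrite -(inj_eq val_inj) linear0.
Qed.

Definition std_resolution : proj_resolution M :=
  @ProjResolution M (fun i => cover (syzygy i)) std_d (counit M)
    (fun i => @cover_projective (syzygy i)) (@counit_epi M) (@std_d_img 0) std_exact.

End StandardResolution.

Definition Ext (i : nat) (M N : pmod) : vectType k :=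
  cohomology (std_resolution M) N i.

End PersistenceModules.

Definition grid (n : nat) : finPOrderType _ := ('I_n.+1 *p 'I_n.+1)%type.

Lemma le_grid n (x y : grid n) :
  (x <= y)%O = (x.1 <= y.1)%N && (x.2 <= y.2)%N.
Proof. by []. Qed.

Definition diag_mod (k : fieldType) (n : nat) : pmod (grid n) k :=
  dsum (fun j : 'I_n.+1 => simple_mod k ((j, j) : grid n)).

Definition linearly_isomorphic (k : fieldType) (U V : vectType k) : Prop :=
  exists f : {linear U -> V}, bijective f.

Definition grows_linearly (f : nat -> nat) : Prop :=
  exists a b, (0 < a)%N /\ forall n, (1 <= n)%N -> f n = (a * n + b)%N.

(* Main.v *)
(** For covariant modules over a grid, the simple module at [(j, j)] has the
    Koszul resolution
      [0 -> k[(j+1, j+1)] -> k[(j+1, j)] + k[(j, j+1)] -> k[(j, j)]],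
    where [k[v]] is the indicator module of the up-set of [v], which is projective,
    and [Hom(k[v], N) = N v] (both vanish when [v] lies outside the grid). Taking
    the direct sum over [j], the diagonal support of [M] kills the terms in degrees
    1 and 3 of [Hom(_, M)]; so [Ext^2(M, M)] is the whole degree 2 term, which has
    one dimension for each [j < n]. The standard resolution is replaced by this one
    by comparing dimensions: a chain map with a left homotopy inverse induces an
    injection in cohomology, and two resolutions inject into each other. *)

From HB Require Import structures.
From mathcomp Require Import all_boot all_order all_algebra.
From mathcomp Require Import zify.
Require Import Defs.

Set Implicit Arguments.
Unset Strict Implicit.
Unset Printing Implicit Defensive.

Import Order.TTheory GRing.Theory.
Import VectorInternalTheory.
Local Open Scope ring_scope.

(** Serves to build chain maps and homotopies degree by degree. The relations are boolean on choice
    types, so [xchoose] supplies each next term; the invariant [I] guarantees that one exists. *)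
Lemma dependent_choice (T : nat -> choiceType) (I : forall i, pred (T i))
    (r : forall i, T i -> T i.+1 -> bool) (x0 : T 0) :
  I 0 x0 -> (forall i x, I i x -> exists2 y, I i.+1 y & r i x y) ->
  exists2 f : forall i, T i, f 0 = x0 & forall i, r i (f i) (f i.+1).
Proof.
move=> I0 IS.
have exS i (u : {x | I i x}) : exists y, I i.+1 y && r i (sval u) y.
  by have [y Iy rxy] := IS i _ (svalP u); exists y; rewrite Iy.
pose next i (u : {x | I i x}) : {x | I i.+1 x} :=
  exist (I i.+1) _ (proj1 (andP (xchooseP (exS i u)))).
pose u := nat_rect (fun i => {x | I i x}) (exist (I 0) x0 I0) next.
exists (fun i => sval (u i)) => // i.
exact: proj2 (andP (xchooseP (exS i (u i)))).
Qed.

(** * Dimension counts *)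

Section LinearAlgebra.
Variable k : fieldType.

(* [g] induces an injection of [Z / B] into [Z' / B']. *)
Lemma leq_dim_quotient (V V' : vectType k) (B Z : {vspace V})
    (B' Z' : {vspace V'}) (g : 'Hom(V, V')) :
  (B' <= Z')%VS -> (forall z, z \in Z -> g z \in Z') ->
  (forall z, z \in Z -> g z \in B' -> z \in B) -> (B <= Z)%VS ->
  (\dim Z - \dim B <= \dim Z' - \dim B')%N.
Proof.
move=> sB'Z' gZ gB sBZ.
have sZ : (g @: Z + B' <= Z')%VS.
  rewrite subv_add sB'Z' andbT; apply/subvP=> _ /memv_imgP[z Zz ->]; exact: gZ.
have sI : (g @: Z :&: B' <= g @: B)%VS.
  apply/subvP=> y; rewrite memv_cap => /andP[/memv_imgP[z Zz ->] /(gB z Zz) Bz].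
  exact: memv_img.
have sK : (Z :&: lker g <= B :&: lker g)%VS.
  apply/subvP=> z; rewrite !memv_cap => /andP[Zz Kz]; rewrite Kz andbT.
  by apply: gB => //; rewrite memv_ker in Kz; rewrite (eqP Kz) mem0v.
(* Rank-nullity on [Z] and [B] bounds the left side by [dim g(Z) - dim g(B)], hence by
   [dim g(Z) - dim (g(Z) :&: B')], which is [dim (g(Z) + B') - dim B']. *)
have := dimvS sZ; have := dimvS sI; have := dimvS sK; have := dimvS sBZ.
have := dimvS sB'Z'; have := dimv_sum_cap (g @: Z) B'.
have := limg_ker_dim g Z; have := limg_ker_dim g B.
lia.
Qed.

Lemma limg_full (U V : vectType k) (f : 'Hom(U, V)) :
  (forall y, exists x, f x = y) -> limg f = fullv.
Proof.
move=> surj; apply/vspaceP=> y; have [x <-] := surj y.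
by rewrite memvf memv_img ?memvf.
Qed.

Lemma dim_quotv (V : vectType k) (W : {vspace V}) :
  \dim {: quotv W} = (\dim {: V} - \dim W)%N.
Proof.
pose pi := linfun (@qclass k V W).
have kpi : lker pi = W.
  apply/vspaceP=> v; rewrite memv_ker lfunE /=.
  by rewrite -[0](linear0 (@qclass k V W)) qclass_eq subr0.
have <- : limg pi = fullv.
  by apply: limg_full => q; exists (qrepr q); rewrite lfunE /= qreprK.
by rewrite -(limg_ker_dim pi fullv) capfv kpi addKn.
Qed.

Lemma linearly_isomorphic_rV (V : vectType k) n :
  \dim {: V} = n -> linearly_isomorphic V 'rV[k]_n.
Proof.
rewrite dimvf => <-; exists (v2r : {linear V -> _}).
by exists (@r2v k V); [apply: v2rK | apply: r2vK].
Qed.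

Lemma dim_iso (U V : vectType k) (f : {linear U -> V}) :
  bijective f -> \dim {: U} = \dim {: V}.
Proof.
case=> g fK gK.
have <- : limg (linfun f) = fullv.
  by apply: limg_full => y; exists (g y); rewrite lfunE /= gK.
rewrite limg_dim_eq //; apply/vspaceP=> x.
by rewrite capfv memv_ker lfunE /= memv0 -(inj_eq (can_inj fK) x) linear0.
Qed.

Lemma dim_dffun (I : finType) (T : I -> vectType k) :
  \dim {: {dffun forall i : I, T i}} = (\sum_i \dim {: T i})%N.
Proof.
rewrite dimvf (eq_bigr _ (fun i _ => dimvf (T i))).
by rewrite [RHS](reindex _ (onW_bij _ (enum_val_bij I))).
Qed.
End LinearAlgebra.

(** * Comparison of projective resolutions *)

Section Homology.
Variables (disp : Order.disp_t) (P : finPOrderType disp) (k : fieldType).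
Local Notation pmod := (pmod P k).
Implicit Types L M N Q : pmod.

Lemma hom_ext M N (f g : hom M N) :
  (forall p x, homc f p x = homc g p x) -> f = g.
Proof. by move=> e; apply: homP => p; apply/lfunP => x; apply: e. Qed.

Lemma homcD M N (f g : hom M N) p x :
  homc (f + g) p x = homc f p x + homc g p x.
Proof. by rewrite /homc linearD /= ffunE lfunE. Qed.

Lemma homc0 M N p x : homc (0 : hom M N) p x = 0.
Proof. by rewrite /homc linear0 ffunE lfunE. Qed.

Lemma homcZ M N a (f : hom M N) p x : homc (a *: f) p x = a *: homc f p x.
Proof. by rewrite /homc linearZ /= ffunE lfunE. Qed.

Lemma homcN M N (f : hom M N) p x : homc (- f) p x = - homc f p x.
Proof. by rewrite -scaleN1r homcZ scaleN1r. Qed.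

Lemma homcompA L M N Q (h : hom N Q) (g : hom M N) (f : hom L M) :
  homcomp h (homcomp g f) = homcomp (homcomp h g) f.
Proof. by apply: hom_ext => p x; rewrite !comp_mkhom. Qed.

Lemma homcomp0r L M N (g : hom M N) : homcomp g (0 : hom L M) = 0.
Proof. by apply: hom_ext => p x; rewrite comp_mkhom !homc0 linear0. Qed.

Lemma homcomp0l L M N (f : hom L M) : homcomp (0 : hom M N) f = 0.
Proof. by apply: hom_ext => p x; rewrite comp_mkhom !homc0. Qed.

Lemma homcompBr L M N (g : hom M N) (f f' : hom L M) :
  homcomp g (f - f') = homcomp g f - homcomp g f'.
Proof.
by apply: hom_ext => p x; rewrite !(comp_mkhom, homcD, homcN) linearB.
Qed.

Lemma homcompDr L M N (g : hom M N) (f f' : hom L M) :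
  homcomp g (f + f') = homcomp g f + homcomp g f'.
Proof.
by apply: hom_ext => p x; rewrite !(comp_mkhom, homcD) linearD.
Qed.

Lemma homcompBl L M N (g g' : hom M N) (f : hom L M) :
  homcomp (g - g') f = homcomp g f - homcomp g' f.
Proof. by apply: hom_ext => p x; rewrite !(comp_mkhom, homcD, homcN). Qed.

Fact hom_id_subproof M p q (pq : (p <= q)%O) :
  (pmap M pq \o \1 = \1 \o pmap M pq)%VF.
Proof. by rewrite comp_lfun1l comp_lfun1r. Qed.
Definition hom_id M : hom M M := mkhom (@hom_id_subproof M).

Lemma hom_idE M p x : homc (hom_id M) p x = x.
Proof. by rewrite mkhomE lfunE. Qed.

Lemma homcomp1l M N (f : hom M N) : homcomp (hom_id N) f = f.
Proof. by apply: hom_ext => p x; rewrite comp_mkhom hom_idE. Qed.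

Lemma homcomp1r M N (f : hom M N) : homcomp f (hom_id M) = f.
Proof. by apply: hom_ext => p x; rewrite comp_mkhom hom_idE. Qed.

Fact ker_lift_subproof L M N (g : hom M N) (f : hom L M) :
  homcomp g f = 0 ->
  exists f' : hom L (kermod g), homcomp (ker_incl g) f' = f.
Proof.
move=> gf0.
have Kf p x : homc f p x \in lker (homc g p).
  by rewrite memv_ker -comp_mkhom gf0 homc0.
pose F p : 'Hom(L p, kermod g p) :=
  (linfun (vsproj (lker (homc g p))) \o homc f p)%VF.
have FE p x : vsval (F p x) = homc f p x.
  by rewrite comp_lfunE /= lfunE /= vsprojK //; apply: Kf.
have nF p q (pq : (p <= q)%O) : (pmap (kermod g) pq \o F p = F q \o pmap L pq)%VF.
  apply/lfunP=> x; apply/val_inj; rewrite comp_lfunE [in RHS]comp_lfunE.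
  apply: etrans (ker_mapE pq (F p x)) _; rewrite FE hom_natE.
  exact: esym (FE _ _).
exists (mkhom nF); apply: hom_ext => p x.
by rewrite comp_mkhom ker_inclE mkhomE FE.
Qed.

(** Both [f] and [h] factor through the kernel of [g]; exactness makes the factor of [f] an
    epimorphism, along which projectivity lifts the factor of [h]. *)
Lemma projective_lift Q L M N (f : hom L M) (g : hom M N) (h : hom Q M) :
  projective Q -> (forall p, limg (homc f p) = lker (homc g p)) ->
  homcomp g h = 0 -> exists h', homcomp f h' = h.
Proof.
move=> projQ exact_fg gh0.
have gf0 : homcomp g f = 0.
  apply: hom_ext => p x; rewrite comp_mkhom homc0; apply/eqP.
  by rewrite -memv_ker -exact_fg memv_img ?memvf.
have [f' f'E] := ker_lift_subproof gf0; have [h' h'E] := ker_lift_subproof gh0.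
have epi_f' : epi f'.
  move=> p; apply: limg_full => y.
  have : vsval y \in limg (homc f p) by rewrite exact_fg subvsP.
  case/memv_imgP=> x _ yE; exists x; apply/val_inj; rewrite /= yE.
  by rewrite -f'E comp_mkhom ker_inclE.
have [h'' h''E] := projQ _ _ _ h' epi_f'.
by exists h''; rewrite -f'E -homcompA h''E.
Qed.

Section Resolution.
Variables (M : pmod) (R : proj_resolution M).

(** Placing [M] below degree 0 makes the augmentation the lowest boundary map, so exactness reads
    the same in all degrees. *)
Definition res_target i : pmod := if i is j.+1 then res_obj R j else M.

Definition res_bd i : hom (res_obj R i) (res_target i) :=
  match i with 0 => res_aug R | j.+1 => res_d R j end.

Lemma res_exact i p : limg (homc (res_d R i) p) = lker (homc (res_bd i) p).
Proof. by case: i => [|i]; [apply: res_exact0 | apply: res_exactS]. Qed.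

Lemma res_bd_d i : homcomp (res_bd i) (res_d R i) = 0.
Proof.
apply: hom_ext => p x; rewrite comp_mkhom homc0; apply/eqP.
by rewrite -memv_ker -res_exact memv_img ?memvf.
Qed.

Lemma res_dd i : homcomp (res_d R i) (res_d R i.+1) = 0.
Proof. exact: res_bd_d i.+1. Qed.

End Resolution.

(** * Existence of chain maps and chain homotopies *)

Section Comparison.
Variables (M : pmod).

Definition chain_map (R R' : proj_resolution M)
    (f : forall i, hom (res_obj R i) (res_obj R' i)) :=
  homcomp (res_aug R') (f 0) = res_aug R /\
  forall i, homcomp (res_d R' i) (f i.+1) = homcomp (f i) (res_d R i).

Lemma chain_map_exists (R R' : proj_resolution M) :
  exists f, @chain_map R R' f.
Proof.
pose T i : choiceType := hom (res_obj R i) (res_obj R' i).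
(* The invariant says that [f d] lands in the cycles, as lifting it through the next differential of
   [R'] requires. *)
pose I i (f : T i) := homcomp (res_bd R' i) (homcomp f (res_d R i)) == 0.
pose r i (f : T i) (f' : T i.+1) :=
  homcomp (res_d R' i) f' == homcomp f (res_d R i).
have [f0 f0E] := res_proj (res_aug R) (res_aug_epi R').
have I0 : I 0 f0 by rewrite /I homcompA f0E (res_bd_d R 0).
case: (@dependent_choice T I r f0 I0) => [i f /eqP If|f fE rf].
  have [f' f'E] := projective_lift (@res_proj _ _ _ _ R i.+1) (res_exact R' i) If.
  exists f'; rewrite /r /I ?f'E // homcompA f'E -homcompA res_dd.
  by rewrite homcomp0r.
by exists f; split=> [|i]; [rewrite fE | apply/eqP/rf].
Qed.

Lemma chain_homotopy_exists (R R' : proj_resolution M) f f' :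
  @chain_map R R' f -> @chain_map R R' f' ->
  exists s : forall i, hom (res_obj R i) (res_obj R' i.+1),
    f 0 - f' 0 = homcomp (res_d R' 0) (s 0) /\
    forall i, f i.+1 - f' i.+1 =
      homcomp (res_d R' i.+1) (s i.+1) + homcomp (s i) (res_d R i).
Proof.
move=> [fa fd] [f'a f'd].
pose h i := f i - f' i.
have hd i : homcomp (res_d R' i) (h i.+1) = homcomp (h i) (res_d R i).
  by rewrite homcompBr homcompBl fd f'd.
pose T i : choiceType := hom (res_obj R i) (res_obj R' i.+1).
(* As [d h = h d], the invariant says that [h i.+1 - s d] is a cycle, so that it lifts to the next
   component of the homotopy. *)
pose I i (s : T i) :=
  homcomp (res_d R' i) (homcomp s (res_d R i)) == homcomp (h i) (res_d R i).
pose r i (s : T i) (s' : T i.+1) :=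
  homcomp (res_d R' i.+1) s' == h i.+1 - homcomp s (res_d R i).
have [s0 s0E] : exists s0, homcomp (res_d R' 0) s0 = h 0.
  apply: (projective_lift (g := res_bd R' 0) (@res_proj _ _ _ _ R 0)).
    exact: res_exact.
  by rewrite homcompBr fa f'a subrr.
have I0 : I 0 s0 by rewrite /I homcompA s0E.
case: (@dependent_choice T I r s0 I0) => [i s /eqP Is|s sE rs].
  have [|s' s'E] := projective_lift (h := h i.+1 - homcomp s (res_d R i))
    (@res_proj _ _ _ _ R i.+1) (res_exact R' i.+1).
    by rewrite homcompBr hd Is subrr.
  exists s'; rewrite /r /I ?s'E // homcompA s'E homcompBl -homcompA res_dd.
  by rewrite homcomp0r subr0.
exists s; split=> [|i]; first by rewrite sE s0E.
by rewrite (eqP (rs i)) subrK.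
Qed.

Lemma chain_map_id R : @chain_map R R (fun i => hom_id _).
Proof. by split=> [|i]; rewrite ?homcomp1l homcomp1r. Qed.

Lemma chain_map_comp R1 R2 R3 g f : @chain_map R2 R3 g -> @chain_map R1 R2 f ->
  @chain_map R1 R3 (fun i => homcomp (g i) (f i)).
Proof.
move=> [ga gd] [fa fd]; split=> [|i]; first by rewrite homcompA ga.
by rewrite homcompA gd -homcompA fd homcompA.
Qed.

(** * Independence of cohomology from the resolution *)

Lemma mem_cocycles (R : proj_resolution M) N i (z : hom (res_obj R i) N) :
  (z \in cocycles R N i) = (homcomp z (res_d R i) == 0).
Proof. by rewrite memv_ker lfunE. Qed.

Lemma mem_coboundariesS (R : proj_resolution M) N i (w : hom (res_obj R i) N) :
  homcomp w (res_d R i) \in coboundaries R N i.+1.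
Proof.
by rewrite -[homcomp _ _](lfunE (precomp (N := N) (res_d R i))) memv_img ?memvf.
Qed.

Lemma coboundariesSP (R : proj_resolution M) N i (z : hom (res_obj R i.+1) N) :
  z \in coboundaries R N i.+1 -> exists w, z = homcomp w (res_d R i).
Proof. by case/memv_imgP => w _ ->; exists w; rewrite lfunE. Qed.

Lemma coboundaries_sub (R : proj_resolution M) N i :
  (coboundaries R N i <= cocycles R N i)%VS.
Proof.
case: i => [|i]; first exact: sub0v.
apply/subvP=> z /coboundariesSP[w ->].
by rewrite mem_cocycles -homcompA res_dd homcomp0r.
Qed.

(** The inclusion of the cocycles is injective and its image contains the coboundaries, so taking
    their preimage preserves the dimension. *)
Lemma dim_cohomology (R : proj_resolution M) N i :
  \dim {: cohomology R N i} =
  (\dim (cocycles R N i) - \dim (coboundaries R N i))%N.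
Proof.
rewrite dim_quotv [\dim {: subvs_of _}]dimvf.
set Z := cocycles R N i; set B := coboundaries R N i.
pose v := linfun (vsval : subvs_of Z -> _); congr (_ - _)%N.
have vE x : v x = vsval x by rewrite lfunE.
rewrite -(limg_dim_eq (f := v)); last first.
  apply/vspaceP=> x; rewrite memv_cap memv_ker memv0 vE.
  have -> : (vsval x == 0) = (x == 0) by rewrite -(inj_eq val_inj) linear0.
  by rewrite andb_idl // => /eqP ->; apply: mem0v.
congr (\dim _); apply: lpreimK; apply/subvP=> z Bz.
have Zz : z \in Z by apply: subvP Bz; apply: coboundaries_sub.
by rewrite -[z](vE (Subvs Zz)) memv_img ?memvf.
Qed.

(** Precomposition with [g] is injective on cohomology, because [g f] is homotopic to the identity
    of [R]. *)
Lemma leq_dim_cohomology (R R' : proj_resolution M) N i :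
  (\dim {: cohomology R N i} <= \dim {: cohomology R' N i})%N.
Proof.
have [f cf] := chain_map_exists R R'; have [g cg] := chain_map_exists R' R.
have [s [s0 sS]] := chain_homotopy_exists (chain_map_comp cg cf) (chain_map_id R).
rewrite !dim_cohomology.
pose G : 'Hom(_, _) := linfun (precomp (N := N) (g i)).
have GE z : G z = homcomp z (g i) by rewrite lfunE.
apply: (leq_dim_quotient (g := G)); rewrite ?coboundaries_sub // => z.
  rewrite !mem_cocycles GE => /eqP zd.
  by rewrite -homcompA -(proj2 cg) homcompA zd homcomp0l.
rewrite mem_cocycles GE => /eqP zd.
(* In degree 0 the only coboundary is 0, and the homotopy has the single term [d s], killed by the
   cocycle [z]. *)
case: i => [|i] in z zd G GE *.
  rewrite memv0 => /eqP zg0; rewrite memv0; apply/eqP.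
  rewrite -[z]homcomp1r -[hom_id _](subKr (homcomp (g 0) (f 0))) s0.
  by rewrite homcompBr !homcompA zg0 zd !homcomp0l subr0.
case/coboundariesSP=> w zgE.
(* Writing the identity as [g f - (d s + s d)] turns [z] into [(w f - z s) d], since [z d = 0] and
   [z g = w d]. *)
rewrite -[z]homcomp1r -[hom_id _](subKr (homcomp (g i.+1) (f i.+1))) sS.
rewrite homcompBr homcompA zgE homcompDr !homcompA zd homcomp0l add0r.
rewrite -(homcompA w) (proj2 cf) homcompA -homcompBl.
exact: mem_coboundariesS.
Qed.

Lemma dim_cohomology_unique (R R' : proj_resolution M) N i :
  \dim {: cohomology R N i} = \dim {: cohomology R' N i}.
Proof. by apply/eqP; rewrite eqn_leq !leq_dim_cohomology. Qed.

End Comparison.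

End Homology.

(** * Indicator modules of up-sets *)

Section BooleanSpace.
Variable k : fieldType.
Implicit Types b c : bool.

(* Embeds k^b, of dimension 0 or 1, into k: the modules below have such spaces as
   values, and their elements are compared through [bval]. *)
Definition bval b (x : 'rV[k]_b) : k := \sum_i x 0 i.

Fact bval_is_scalar b : scalar (@bval b).
Proof.
move=> a x y; rewrite /bval mulr_sumr -big_split.
by apply: eq_bigr => i _; rewrite !mxE.
Qed.
HB.instance Definition _ b := GRing.isLinear.Build k _ _ _ (@bval b)
  (@bval_is_scalar b).

Lemma bvalE b (x : 'rV[k]_b) i : bval x = x 0 i.
Proof. exact: sum_bool. Qed.

Lemma bval_inj b : injective (@bval b).
Proof. by move=> x y e; apply/rowP => i; rewrite -!bvalE. Qed.

Lemma bval_neq0 b (x : 'rV[k]_b) : bval x != 0 -> b.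
Proof. by case: b x => // x; rewrite /bval big_ord0 eqxx. Qed.

Lemma bval_const b (a : k) : bval (const_mx a : 'rV_b) = a *+ b.
Proof.
by rewrite /bval (eq_bigr _ (fun i _ => mxE _ _ _ i)) sumr_const card_ord.
Qed.

Lemma bval_mul b c (x : 'rV[k]_b) : bval (x *m const_mx 1 : 'rV_c) = bval x *+ c.
Proof.
have -> : x *m const_mx 1 = const_mx (bval x) :> 'rV_c; last exact: bval_const.
by apply/rowP=> i; rewrite !mxE; apply: eq_bigr => l _; rewrite mxE mulr1.
Qed.

Lemma bval_linfun b c (x : 'rV[k]_b) :
  bval (linfun (mulmxr (const_mx 1 : 'M_(b, c))) x) = bval x *+ c.
Proof. by rewrite lfunE /= bval_mul. Qed.

End BooleanSpace.

Section UpSets.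
Variables (disp : Order.disp_t) (P : finPOrderType disp) (k : fieldType).
Implicit Types (M N : pmod P k) (p q v : P).

Definition up_closed (U : pred P) := forall p q, (p <= q)%O -> U p -> U q.

Section UpModule.
Variables (U : pred P) (upU : up_closed U).

Definition up_obj p : vectType k := 'rV[k]_(U p).

Definition up_map p q (_ : (p <= q)%O) : 'Hom(up_obj p, up_obj q) :=
  linfun (mulmxr (const_mx 1 : 'M[k]_(U p, U q))).

(** A nonzero [x] forces [p] into [U], hence [q] as well, and the matrix is then the identity of
    k^1. *)
Lemma bval_up_map p q (pq : (p <= q)%O) x : bval (up_map pq x) = bval x.
Proof.
rewrite /up_map bval_linfun; have [->|/bval_neq0 Up] := eqVneq (bval x) 0.
  by rewrite mul0rn.
by rewrite (upU pq Up).
Qed.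

Fact up_id p (pp : (p <= p)%O) : up_map pp = \1%VF.
Proof. by apply/lfunP=> x; apply: bval_inj; rewrite bval_up_map lfunE. Qed.

Fact up_comp p q r (pq : (p <= q)%O) (qr : (q <= r)%O) (pr : (p <= r)%O) :
  up_map pr = (up_map qr \o up_map pq)%VF.
Proof.
by apply/lfunP=> x; apply: bval_inj; rewrite comp_lfunE !bval_up_map.
Qed.

Definition up_mod := PMod up_id up_comp.

Lemma bval_pmap p q (pq : (p <= q)%O) (x : up_mod p) :
  bval (pmap up_mod pq x) = bval x.
Proof. exact: bval_up_map. Qed.

Lemma up_mod_empty N (f g : hom up_mod N) : U =1 pred0 -> f = g.
Proof.
move=> U0; apply: hom_ext => p x.
have -> : x = 0; last by rewrite !linear0.
apply: bval_inj; apply/eqP; apply: contraFT (U0 p).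
by rewrite linear0 => /bval_neq0.
Qed.

(** * Yoneda lemma for principal up-sets *)

Section Principal.
Variables (v : P) (Uv : U =1 (fun p => (v <= p)%O)).

Lemma le_generator p (i : 'I_(U p)) : (v <= p)%O.
Proof. by rewrite -Uv; case: (U p) i => // -[]. Qed.

Definition generator : up_mod v := const_mx 1.

Lemma bval_generator : bval generator = 1.
Proof. by rewrite bval_const Uv lexx. Qed.

(* At most one summand, whose index provides the proof of [v <= p]. *)
Definition up_hom_fun N (y : N v) p (x : up_mod p) : N p :=
  \sum_(i < U p) bval x *: pmap N (le_generator i) y.

Fact up_hom_fun_is_linear N (y : N v) p : linear (@up_hom_fun N y p).
Proof.
move=> a x x'; rewrite /up_hom_fun scaler_sumr -big_split.
by apply: eq_bigr => i _; rewrite linearP scalerDl scalerA.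
Qed.
HB.instance Definition _ N (y : N v) p := GRing.isLinear.Build k _ _ _
  (@up_hom_fun N y p) (@up_hom_fun_is_linear N y p).

(** Any [x] is [bval x] times the transported generator, so naturality determines [f] from its value
    there. *)
Lemma hom_up_modE N (f : hom up_mod N) p x :
  homc f p x = up_hom_fun (homc f v generator) x.
Proof.
rewrite /up_hom_fun; have [x0|nz] := eqVneq (bval x) 0.
  rewrite big1 => [|i _]; last by rewrite x0 scale0r.
  have -> : x = 0 by apply: bval_inj; rewrite x0 linear0.
  by rewrite linear0.
have i : 'I_(U p) by rewrite (bval_neq0 nz); exact: ord0.
rewrite (sum_bool i) hom_natE -linearZ; congr (homc f p _); apply: bval_inj.
by rewrite linearZ /= (bval_pmap (le_generator i)) bval_generator mulr1.
Qed.

Fact up_hom_subproof N (y : N v) p q (pq : (p <= q)%O) :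
  (pmap N pq \o linfun (@up_hom_fun N y p) =
   linfun (@up_hom_fun N y q) \o pmap up_mod pq)%VF.
Proof.
apply/lfunP=> x; rewrite !comp_lfunE !(lfunE (@up_hom_fun N y _)) /=.
rewrite /up_hom_fun linear_sum (bval_pmap pq); have [x0|nz] := eqVneq (bval x) 0.
  by rewrite !big1 // => i _; rewrite x0 scale0r ?linear0.
have Up := bval_neq0 nz.
have i : 'I_(U p) by rewrite Up; exact: ord0.
have j : 'I_(U q) by rewrite (upU pq Up); exact: ord0.
rewrite (sum_bool i) (sum_bool j) linearZ /=.
by rewrite (pmap_comp N (le_generator i) pq) comp_lfunE.
Qed.

Definition up_hom N (y : N v) : hom up_mod N := mkhom (@up_hom_subproof N y).

Lemma up_hom_generator N (y : N v) : homc (up_hom y) v generator = y.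
Proof.
have i : 'I_(U v) by rewrite Uv lexx; exact: ord0.
rewrite mkhomE lfunE /= /up_hom_fun (sum_bool i) bval_generator scale1r.
by rewrite pmap_id lfunE.
Qed.

Lemma eq_hom_up_mod N (f g : hom up_mod N) :
  homc f v generator = homc g v generator -> f = g.
Proof. by move=> e; apply: hom_ext => p x; rewrite hom_up_modE e -hom_up_modE. Qed.

(** Evaluation at the generator is linear, with inverse [up_hom]. *)
Lemma dim_hom_up_mod N : \dim {: hom up_mod N} = \dim {: N v}.
Proof.
pose ev (f : hom up_mod N) := homc f v generator.
have evL : linear ev by move=> a f g; rewrite /ev homcD homcZ.
pose evl : {linear _ -> _} := HB.pack ev (GRing.isLinear.Build _ _ _ _ ev evL).
apply: (dim_iso (f := evl)); exists (@up_hom N) => [f|y].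
  by apply: eq_hom_up_mod; rewrite up_hom_generator.
exact: up_hom_generator.
Qed.

(** By Yoneda it is enough to choose a preimage under [g] of the image of the generator. *)
Lemma up_mod_projective_principal : projective up_mod.
Proof.
move=> M N g h epi_g.
exists (up_hom ((homc g v)^-1%VF (homc h v generator))).
apply: eq_hom_up_mod; rewrite comp_mkhom up_hom_generator.
exact: epi_sect.
Qed.

End Principal.
End UpModule.

(** * Inclusions of indicator modules and maps to simples *)

Section UpModuleHom.
Variables (U V : pred P) (upU : up_closed U) (upV : up_closed V).
Hypothesis sUV : subpred U V.

Definition up_incl_map p : 'Hom(up_mod upU p, up_mod upV p) :=
  linfun (mulmxr (const_mx 1 : 'M[k]_(U p, V p))).

Lemma bval_up_incl_map p x : bval (up_incl_map p x) = bval x.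
Proof.
rewrite /up_incl_map bval_linfun; have [->|/bval_neq0 Up] := eqVneq (bval x) 0.
  by rewrite mul0rn.
by rewrite (sUV Up).
Qed.

Fact up_incl_subproof p q (pq : (p <= q)%O) :
  (pmap (up_mod upV) pq \o up_incl_map p =
   up_incl_map q \o pmap (up_mod upU) pq)%VF.
Proof.
apply/lfunP=> x; apply: bval_inj.
by rewrite !comp_lfunE (bval_pmap pq) !bval_up_incl_map (bval_pmap pq).
Qed.
Definition up_incl : hom (up_mod upU) (up_mod upV) := mkhom up_incl_subproof.

Lemma bval_up_incl p x : bval (homc up_incl p x) = bval x.
Proof. by rewrite mkhomE bval_up_incl_map. Qed.

End UpModuleHom.

Section UpModuleTop.
Variables (U : pred P) (upU : up_closed U) (v : P).
Hypothesis min_v : forall p, U p -> (p <= v)%O -> p = v.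

Definition up_top_map p : 'Hom(up_mod upU p, simple_mod k v p) :=
  linfun (mulmxr (const_mx 1 : 'M[k]_(U p, p == v))).

Lemma bval_up_top_map p x : bval (up_top_map p x) = bval x *+ (p == v).
Proof. exact: bval_linfun. Qed.

Fact up_top_subproof p q (pq : (p <= q)%O) :
  (pmap (simple_mod k v) pq \o up_top_map p =
   up_top_map q \o pmap (up_mod upU) pq)%VF.
Proof.
apply/lfunP=> x; apply: bval_inj; rewrite !comp_lfunE.
rewrite [LHS]bval_linfun !bval_up_top_map (bval_pmap pq) -mulrnA mulnb.
have [->|/bval_neq0 Up] := eqVneq (bval x) 0; first by rewrite !mul0rn.
(* Only [q = v] can give a nonzero value; then [p <= v] with [p] in [U], and minimality gives
   [p = v]. *)
have [e|] := eqVneq q v; last by rewrite andbF.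
suff -> : (p == v) by [].
by apply/eqP/min_v; rewrite // -e.
Qed.
Definition up_top : hom (up_mod upU) (simple_mod k v) := mkhom up_top_subproof.

Lemma bval_up_top p x : bval (homc up_top p x) = bval x *+ (p == v).
Proof. by rewrite mkhomE bval_up_top_map. Qed.

End UpModuleTop.

(** * Finite direct sums of resolutions *)

Section DirectSumResolution.
Variable I : finType.

Section DirectSumMap.
Variables (F G : I -> pmod P k) (h : forall i, hom (F i) (G i)).

Definition dsum_homs : hom (dsum F) (dsum G) :=
  dsum_hom (fun i => homcomp (dsum_incl G i) (h i)).

Lemma dsum_homsE p f i : homc dsum_homs p f i = homc (h i) p (f i).
Proof.
rewrite dsum_homE /dsum_hom_fun.
have := dsum_decomp ([ffun i => homc (h i) p (f i)] : dsum G p).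
under eq_bigr do rewrite ffunE -comp_mkhom.
by move=> <-; rewrite ffunE.
Qed.

Lemma mem_lker_dsum_homs p f :
  (f \in lker (homc dsum_homs p)) = [forall i, f i \in lker (homc (h i) p)].
Proof.
rewrite memv_ker; apply/eqP/forallP => [e i|e].
  by rewrite memv_ker -dsum_homsE e ffunE.
by apply/ffunP=> i; rewrite dsum_homsE ffunE; apply/eqP; rewrite -memv_ker.
Qed.

(** Preimages are chosen separately in the finitely many components. With the analogue for kernels,
    exactness of a direct sum reduces to that of its summands. *)
Lemma mem_limg_dsum_homs p g :
  (g \in limg (homc dsum_homs p)) = [forall i, g i \in limg (homc (h i) p)].
Proof.
apply/idP/forallP => [/memv_imgP[f _ ->] i|e].
  by rewrite dsum_homsE memv_img ?memvf.
have /fin_all_exists[f fE] i : exists x, g i = homc (h i) p x.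
  by have /memv_imgP[x _ ->] := e i; exists x.
have -> : g = homc dsum_homs p [ffun i => f i].
  by apply/ffunP=> i; rewrite dsum_homsE ffunE fE.
by rewrite memv_img ?memvf.
Qed.

End DirectSumMap.

Variables (F : I -> pmod P k) (R : forall i, proj_resolution (F i)).

Fact dsum_res_proj j : projective (dsum (fun i => res_obj (R i) j)).
Proof. by apply: dsum_projective => i; apply: res_proj. Qed.

Fact dsum_res_aug_epi : epi (dsum_homs (fun i => res_aug (R i))).
Proof.
move=> p; apply/vspaceP=> f; rewrite memvf mem_limg_dsum_homs.
by apply/forallP=> i; rewrite res_aug_epi memvf.
Qed.

Fact dsum_res_exact0 p :
  limg (homc (dsum_homs (fun i => res_d (R i) 0)) p) =
  lker (homc (dsum_homs (fun i => res_aug (R i))) p).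
Proof.
apply/vspaceP=> f; rewrite mem_limg_dsum_homs mem_lker_dsum_homs.
by apply: eq_forallb => i; rewrite res_exact0.
Qed.

Fact dsum_res_exactS j p :
  limg (homc (dsum_homs (fun i => res_d (R i) j.+1)) p) =
  lker (homc (dsum_homs (fun i => res_d (R i) j)) p).
Proof.
apply/vspaceP=> f; rewrite mem_limg_dsum_homs mem_lker_dsum_homs.
by apply: eq_forallb => i; rewrite res_exactS.
Qed.

Definition dsum_resolution : proj_resolution (dsum F) :=
  ProjResolution dsum_res_proj dsum_res_aug_epi dsum_res_exact0 dsum_res_exactS.

End DirectSumResolution.

(** Universal property of the direct sum: restriction to the summands is inverse to [dsum_hom]. *)
Lemma dim_hom_dsum (I : finType) (F : I -> pmod P k) N :
  \dim {: hom (dsum F) N} = (\sum_i \dim {: hom (F i) N})%N.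
Proof.
rewrite -dim_dffun.
pose res (f : hom (dsum F) N) : {dffun forall i, hom (F i) N} :=
  [ffun i => homcomp f (dsum_incl F i)].
have resL : linear res.
  move=> a f g; apply/ffunP=> i; rewrite !ffunE; apply: hom_ext => p x.
  by rewrite !(comp_mkhom, homcD, homcZ).
pose resl : {linear _ -> _} := HB.pack res (GRing.isLinear.Build _ _ _ _ res resL).
apply: (dim_iso (f := resl)).
exists (fun h : {dffun forall i, hom (F i) N} => dsum_hom (fun i => h i))
  => [f|h].
  apply: hom_ext => p x; rewrite dsum_homE [in RHS](dsum_decomp x) linear_sum.
  by apply: eq_bigr => i _; rewrite ffunE comp_mkhom.
apply/ffunP=> i; rewrite ffunE; apply: hom_ext => p x.
rewrite comp_mkhom dsum_homE /dsum_hom_fun (bigD1 i) //= big1 ?addr0.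
  by rewrite dsum_inclE dfwith_in.
by move=> j ne; rewrite dsum_inclE dfwith_out ?linear0 // eq_sym.
Qed.

End UpSets.

(** * Resolution of the diagonal module *)

Section Grid.
Variables (k : fieldType) (n : nat).
Local Notation G := (grid n).
Implicit Types (a b : nat) (p q : G).

(* The bounds are not restricted to the grid: beyond it the quadrant is empty and
   its indicator module is zero. *)
Definition quadrant a b : pred G := fun p => (a <= p.1)%N && (b <= p.2)%N.

Lemma quadrant_up a b : up_closed (quadrant a b).
Proof.
move=> p q; rewrite le_grid /quadrant => /andP[le1 le2] /andP[ap bp].
by rewrite (leq_trans ap le1) (leq_trans bp le2).
Qed.

Local Notation Q a b := (up_mod k (@quadrant_up a b)).

Lemma quadrant_principal a b : (a <= n)%N -> (b <= n)%N ->
  quadrant a b =1 (fun p => ((inord a, inord b) <= p :> G)%O).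
Proof. by move=> an bn p; rewrite le_grid !inordK. Qed.

Lemma quadrant_empty a b : ~~ ((a <= n) && (b <= n))%N -> quadrant a b =1 pred0.
Proof.
move=> h p; apply/negbTE; apply: contraNN h => /andP[ap bp].
by rewrite (leq_trans ap (leq_ord _)) (leq_trans bp (leq_ord _)).
Qed.

Lemma quadrant_projective a b : projective (Q a b).
Proof.
have [/andP[an bn]|e] := boolP ((a <= n) && (b <= n))%N.
  exact: up_mod_projective_principal (quadrant_principal an bn).
by move=> M N g h _; exists 0; apply: up_mod_empty (quadrant_empty e).
Qed.

(** * Koszul resolution of a diagonal simple *)

Section SimpleResolution.
Variable j : 'I_n.+1.
Local Notation v := ((j, j) : G).

(** The boolean is read as 0 or 1: [side true] is the quadrant of [(j+1, j)], [side false] that of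
    [(j, j+1)]. *)
Definition side (c : bool) : pmod G k := Q (j + c) (j + ~~ c).
Definition sides := dsum side.

(** For [j = n] the quadrants in degrees 1 and 2 are empty, so the same complex covers the last
    vertex. *)
Definition simple_res_obj i : pmod G k :=
  match i with
  | 0 => Q j j
  | 1 => sides
  | 2 => Q j.+1 j.+1
  | _ => Q n.+1 n.+1 (* zero *)
  end.

Fact side_sub (c : bool) : subpred (quadrant (j + c) (j + ~~ c)) (quadrant j j).
Proof. by move=> p; rewrite /quadrant; lia. Qed.

Fact sub_side (c : bool) :
  subpred (quadrant j.+1 j.+1) (quadrant (j + c) (j + ~~ c)).
Proof. by move=> p; rewrite /quadrant; case: c; lia. Qed.

Fact corner_min p : quadrant j j p -> (p <= v)%O -> p = v.
Proof.
rewrite le_grid /quadrant /=; case: p => [p1 p2] /= /andP[a1 a2] /andP[b1 b2].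
by congr (_, _); apply/val_inj/eqP; rewrite eqn_leq ?a1 ?a2 ?b1 ?b2.
Qed.

(** Behind exactness at [Q j j]: an element away from [v] comes from a side. *)
Fact sides_cover p : quadrant j j p -> p != v ->
  exists c : bool, quadrant (j + c) (j + ~~ c) p.
Proof.
case: p => p1 p2; rewrite /quadrant -pair_eqE /= -!val_eqE /=.
by move=> qp pv; exists (j < p1)%N; lia.
Qed.

(** Behind exactness at [sides]: cancelling components can be nonzero only where both sides are
    present. *)
Fact sides_meet p : quadrant (j + true) (j + ~~ true) p ->
  quadrant (j + false) (j + ~~ false) p -> quadrant j.+1 j.+1 p.
Proof. by case: p => p1 p2; rewrite /quadrant /=; lia. Qed.

Definition corner : hom (Q j j) (simple_mod k v) := up_top k _ corner_min.

Definition sides_sum : hom sides (Q j j) :=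
  dsum_hom (fun c => up_incl k _ _ (@side_sub c)).

Definition sides_incl c : hom (Q j.+1 j.+1) sides :=
  homcomp (dsum_incl side c) (up_incl k _ _ (@sub_side c)).

(** The opposite signs make the composite with [sides_sum] vanish. *)
Definition sides_diff : hom (Q j.+1 j.+1) sides :=
  sides_incl true - sides_incl false.

Definition simple_res_d i : hom (simple_res_obj i.+1) (simple_res_obj i) :=
  match i with 0 => sides_sum | 1 => sides_diff | _ => 0 end.

Lemma bval_sides_sum p (f : sides p) :
  bval (homc sides_sum p f) = bval (f true) + bval (f false).
Proof.
rewrite dsum_homE /dsum_hom_fun linear_sum big_bool /=.
by rewrite !bval_up_incl.
Qed.

Lemma bval_sides_diff p x c :
  bval (homc sides_diff p x c) = if c then bval x else - bval x.
Proof.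
rewrite homcD homcN !ffunE !comp_mkhom !dsum_inclE linearD linearN /=.
by case: c; rewrite !dfwith_in !dfwith_out // linear0 ?subr0 ?sub0r bval_up_incl.
Qed.

Fact simple_res_proj i : projective (simple_res_obj i).
Proof.
case: i => [|[|[|i]]]; try exact: quadrant_projective.
by apply: dsum_projective => c; apply: quadrant_projective.
Qed.

Fact corner_epi : epi corner.
Proof.
move=> p; apply: limg_full => y; exists (const_mx (bval y)).
apply: bval_inj; rewrite bval_up_top bval_const.
have [->|/bval_neq0] := eqVneq (bval y) 0; first by rewrite !mul0rn.
move=> pv; have -> : quadrant j j p by rewrite (eqP pv) /quadrant !leqnn.
by rewrite -mulrnA mul1n; have -> : nat_of_bool (p == v) = 1%N by rewrite pv.
Qed.

Fact simple_res_exact0 p : limg (homc sides_sum p) = lker (homc corner p).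
Proof.
apply/vspaceP=> x; rewrite memv_ker.
rewrite -(inj_eq (@bval_inj _ _)) linear0 bval_up_top.
apply/idP/idP=> [/memv_imgP[f _ ->]|].
  rewrite bval_sides_sum; have [pv|_] := eqVneq p v; last by rewrite mulr0n.
  (* Neither side contains [v], so both components vanish there. *)
  have bf0 c : bval (f c) = 0.
    apply/eqP; apply: contraTT isT => /bval_neq0.
    by rewrite pv /quadrant /=; case: (c); lia.
  by rewrite !bf0 addr0 mul0rn.
have [x0 _|nz] := eqVneq (bval x) 0.
  by have -> : x = 0; [apply: bval_inj; rewrite x0 linear0 | exact: mem0v].
rewrite mulrb; case: (eqVneq p v) => [_|pv _]; first by rewrite (negPf nz).
have qp := bval_neq0 nz.
have [c qc] := sides_cover qp pv.
(* The preimage is [x] placed in a side that contains [p]. *)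
apply/memv_imgP; exists (homc (dsum_incl side c) p (const_mx (bval x))).
  exact: memvf.
apply: bval_inj; rewrite bval_sides_sum !dsum_inclE.
by case: c qc => qc; rewrite dfwith_in dfwith_out // linear0 bval_const qc
  ?addr0 ?add0r.
Qed.

Fact simple_res_exact1 p : limg (homc sides_diff p) = lker (homc sides_sum p).
Proof.
apply/vspaceP=> f; rewrite memv_ker.
rewrite -(inj_eq (@bval_inj _ _)) linear0 bval_sides_sum.
apply/idP/idP=> [/memv_imgP[x _ ->]|].
  by rewrite !bval_sides_diff subrr.
rewrite addr_eq0 => /eqP e.
apply/memv_imgP; exists (const_mx (bval (f true))); first exact: memvf.
(* If one component is nonzero, so is the other; then [p] lies in both sides, hence in the quadrant
   of [(j+1, j+1)]. *)
have bf : bval (f true) *+ quadrant j.+1 j.+1 p = bval (f true).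
  have [->|nz] := eqVneq (bval (f true)) 0; first by rewrite mul0rn.
  have := nz; rewrite e oppr_eq0 => /bval_neq0; have := bval_neq0 nz.
  by move=> q1 q2; rewrite (sides_meet q1 q2).
apply/ffunP=> c; apply: bval_inj.
by rewrite bval_sides_diff bval_const bf; case: c; rewrite // e opprK.
Qed.

Fact simple_res_exactS i p :
  limg (homc (simple_res_d i.+1) p) = lker (homc (simple_res_d i) p).
Proof.
case: i => [|i]; first exact: simple_res_exact1.
(* The incoming map is zero, so what remains is injectivity: of [sides_diff] in degree 2, and of a
   map out of the zero module above it. *)
have -> : limg (homc (simple_res_d i.+2) p) = 0%VS.
  apply/vspaceP=> x; rewrite memv0; apply/memv_imgP/eqP => [[y _ ->]|->].
    exact: homc0.
  by exists 0; rewrite ?mem0v ?linear0.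
apply/vspaceP=> x; rewrite memv0 memv_ker.
case: i x => [x|i x]; last first.
  have -> : x = 0; last by rewrite linear0 !eqxx.
  apply: bval_inj; apply/eqP; apply: contraFT (quadrant_empty _ p) => //.
    by rewrite linear0 => /bval_neq0; apply.
  by rewrite ltnn.
apply/eqP/eqP => [->|e]; first by rewrite linear0.
by apply: bval_inj; rewrite -(bval_sides_diff x true) e ffunE !linear0.
Qed.

Definition simple_resolution : proj_resolution (simple_mod k v) :=
  @ProjResolution _ _ _ _ simple_res_obj simple_res_d corner
    simple_res_proj corner_epi simple_res_exact0 simple_res_exactS.

End SimpleResolution.

(** * Dimension of Ext^2 of the diagonal module *)

Definition diag_resolution : proj_resolution (diag_mod k n) :=
  dsum_resolution simple_resolution.

Lemma dim_diag_mod p : \dim {: diag_mod k n p} = (p.1 == p.2).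
Proof.
have -> : \dim {: diag_mod k n p} = (\sum_(i < n.+1) (p == (i, i)))%N.
  rewrite -[diag_mod k n p]/(dsum_obj _ p) dim_dffun; apply: eq_bigr => i _.
  by rewrite dimvf /dim /= mul1n.
(* Only the index [p.1] can satisfy [p = (i, i)]. *)
rewrite (bigD1 p.1) //= big1 => [|i ne]; rewrite -pair_eqE /= ?eqxx ?addn0.
  by rewrite eq_sym.
by rewrite eq_sym (negPf ne).
Qed.

(** Inside the grid this is Yoneda at [(a, b)]; outside it the source is zero. *)
Lemma dim_hom_quadrant a b :
  \dim {: hom (Q a b) (diag_mod k n)} = ((a == b) && (a <= n)%N).
Proof.
have [/andP[an bn]|e] := boolP ((a <= n) && (b <= n))%N.
  rewrite (dim_hom_up_mod _ (quadrant_principal an bn)) dim_diag_mod /=.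
  by rewrite -val_eqE /= !inordK // an andbT.
have -> : (a == b) && (a <= n)%N = false.
  by apply: contraNF e => /andP[/eqP <- ->].
apply/eqP; rewrite dimv_eq0; apply/eqP/vspaceP => f.
by rewrite (up_mod_empty f 0 (quadrant_empty e)) !mem0v.
Qed.

Lemma dim_Ext2_diag : \dim {: Ext 2 (diag_mod k n) (diag_mod k n)} = n.
Proof.
rewrite (dim_cohomology_unique _ diag_resolution) dim_cohomology.
set N := diag_mod k n.
have dim1 : \dim {: hom (res_obj diag_resolution 1) N} = 0%N.
  (* The corners [(j+1, j)] and [(j, j+1)] of the sides lie off the diagonal. *)
  rewrite dim_hom_dsum big1 // => j _; rewrite dim_hom_dsum big1 // => c _.
  by rewrite dim_hom_quadrant eqn_add2l; case: c.
have dim2 : \dim {: hom (res_obj diag_resolution 2) N} = n.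
  (* The summand [j = n] is split off: its quadrant is empty, hence [n] and not [n + 1]. *)
  rewrite dim_hom_dsum big_ord_recr /= dim_hom_quadrant ltnn andbF addn0.
  rewrite (eq_bigr (fun=> 1%N)) ?sum1_card ?card_ord // => j _.
  by rewrite dim_hom_quadrant eqxx ltn_ord.
have dim3 : \dim {: hom (res_obj diag_resolution 3) N} = 0%N.
  rewrite dim_hom_dsum big1 // => j _.
  by rewrite dim_hom_quadrant ltnn andbF.
(* By rank-nullity the coboundaries, coming from a zero space, vanish, and every cochain of degree
   2, mapping to a zero space, is a cocycle. *)
have := limg_ker_dim (codiff diag_resolution N 2) fullv.
have := limg_ker_dim (codiff diag_resolution N 1) fullv.
have := dimvS (subvf (limg (codiff diag_resolution N 2))).
rewrite !capfv dim1 dim2 dim3 -/(cocycles diag_resolution N 2) /=.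
rewrite leqn0 => /eqP-> /eqP; rewrite addn_eq0 => /andP[_ /eqP->].
by rewrite addn0 subn0.
Qed.
End Grid.

Theorem proposition5p7 (k : fieldType) :
  (forall n : nat, (1 <= n)%N ->
     linearly_isomorphic (Ext 2 (diag_mod k n) (diag_mod k n)) 'rV[k]_n) /\
  grows_linearly (fun n : nat => \dim {: Ext 2 (diag_mod k n) (diag_mod k n)}).
Proof.
split=> [n _|]; first exact: linearly_isomorphic_rV (dim_Ext2_diag k n).
by exists 1%N, 0%N; split=> // n _; rewrite dim_Ext2_diag mul1n addn0.
Qed.
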